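(* Let $V_{2k}$ denote the Möbius ladder on $2k$ vertices. If $k\ge 4$ is odd, then the set of lengths of cycles in $V_{2k}$ is exactly the set of even integers from $4$ to $2k$. If $k\ge 4$ is even, then the set of lengths of cycles in $V_{2k}$ is exactly the set consisting of the even integers from $4$ to $2k$ together with all integers from $k+1$ to $2k$.
   Context: For $k\ge 3$, the Möbius ladder $V_{2k}$ is the graph obtained from a cycle $v_0,v_1,\dots,v_{2k-1},v_0$ of length $2k$ by adding the $k$ chords $v_iv_{i+k}$ for $0\le i\le k-1$. The cycle spectrum of a graph is the set of lengths of its cycles. *)

(* Defs.v *)
(* A simple graph is a symmetric irreflexive rel on a finType. *)
From mathcomp Require Import all_boot.

Set Implicit Arguments.
Unset Strict Implicit.
Unset Printing Implicit Defensive.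

(* A cycle is given by the list of its vertices in cyclic order. The bound 3
   excludes [::], [:: x] and an edge traversed back and forth, [:: x; y],
   which ucycle alone would accept. *)
Definition graph_cycle (T : finType) (e : rel T) (c : seq T) : Prop :=
  3 <= size c /\ ucycle e c.

Definition cycle_spectrum (T : finType) (e : rel T) (n : nat) : Prop :=
  exists2 c : seq T, graph_cycle e c & size c = n.

Definition rim_edge (k : nat) (u v : 'I_(2 * k)) : bool :=
  val v == u.+1 %% (2 * k).

Definition chord (k : nat) (u v : 'I_(2 * k)) : bool :=
  (u < k) && (val v == u + k).

(* The ordinal i stands for the vertex v_i; intended for k >= 3. *)
Definition mobius_ladder (k : nat) : rel 'I_(2 * k) :=
  fun u v => [|| rim_edge u v, rim_edge v u, chord u v | chord v u].

Lemma mobius_ladder_sym (k : nat) : symmetric (@mobius_ladder k).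
Proof.
by move=> u v; rewrite /mobius_ladder orbCA; do 2!congr (_ || _); rewrite orbC.
Qed.

Lemma mobius_ladder_irr (k : nat) : 3 <= k -> irreflexive (@mobius_ladder k).
Proof.
move=> k3 u; rewrite /mobius_ladder !orbA !orbb -orbA orbb.
have k0 : 0 < k by apply: leq_trans k3.
apply/norP; split; last first.
  by rewrite /chord negb_and neq_ltn -{1}[val u]addn0 ltn_add2l k0 orbT.
rewrite /rim_edge; have := ltn_ord u; rewrite leq_eqVlt => /orP[/eqP e|lt_u].
  rewrite e modnn; apply/eqP => u0; move: e k3; rewrite [nat_of_ord u]u0.
  by case: (k) => [|[|n]] //; rewrite mulnS.
by rewrite modn_small // eq_sym neq_ltn ltnSn orbT.
Qed.

(* Main.v *)
Require Import Defs.
From mathcomp Require Import all_boot.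
From mathcomp Require Import zify.

(** A closed walk with [a] forward rim steps, [b] backward rim steps and [c]
    chords satisfies [b = a + k * c] modulo [2 * k].  If [k] is odd, this forces
    [a + b + c] to be even.  If [k] is even and [a + b + c] is odd, then [c] is
    odd, so [a] and [b] are congruent modulo [k] but distinct, whence
    [k <= a + b] and the length is at least [k + 1].

    Conversely, the even length [2 * m] is realised by the boundary of a
    block of [m - 1] consecutive squares, and the length [k + 1 + 2 * j] by a cycle that
    zigzags through the chords [0, ..., 2 * j] and returns along the rim. *)

(** Backward steps are added on the left of the congruence to avoid truncated subtraction. *)
Lemma mobius_step (k : nat) (u v : 'I_(2 * k)) : mobius_ladder u v ->
  exists a b c : nat,
    a + b + c = 1 /\ v + b = u + a + k * c %[mod 2 * k].
Proof.
have := ltn_ord u; have := ltn_ord v => hv hu.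
rewrite /mobius_ladder /rim_edge /chord.
case/or4P => [/eqP e|/eqP e|/andP[_ /eqP e]|/andP[_ /eqP e]].
- exists 1, 0, 0; split=> //.
  by rewrite [val v]e addn0 muln0 addn0 addn1 modn_mod.
- exists 0, 1, 0; split=> //.
  by rewrite [val u]e !addn0 muln0 addn0 addn1 modn_mod.
- exists 0, 0, 1; split=> //.
  by rewrite [val v]e !addn0 muln1.
(* A chord taken backwards also counts as [+ k], since [k + k] vanishes modulo [2 * k]. *)
- exists 0, 0, 1; split=> //.
  by rewrite [val u]e !addn0 muln1 -addnA addnn -mul2n modnDr.
Qed.

Lemma mobius_walk (k : nat) (u : 'I_(2 * k)) (p : seq 'I_(2 * k)) :
  path (@mobius_ladder k) u p ->
  exists a b c : nat,
    a + b + c = size p /\ last u p + b = u + a + k * c %[mod 2 * k].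
Proof.
elim: p u => [|v p IHp] u /=.
  by exists 0, 0, 0; split=> //; rewrite muln0 !addn0.
case/andP=> /mobius_step[a [b [c [s1 e1]]]] /IHp[a' [b' [c' [s2 e2]]]].
exists (a + a'), (b + b'), (c + c'); split; first by clear e1 e2; lia.
have -> : last v p + (b + b') = (last v p + b') + b by rewrite addnCA addnC.
rewrite -modnDml e2 modnDml.
have -> : v + a' + k * c' + b = (v + b) + (a' + k * c') by clear e1 e2; lia.
rewrite -modnDml e1 modnDml.
by congr (_ %% _); rewrite mulnDr; clear e1 e2; lia.
Qed.

Lemma mobius_spectrum_steps (k n : nat) :
  cycle_spectrum (@mobius_ladder k) n ->
  exists a b c : nat, a + b + c = n /\ b = a + k * c %[mod 2 * k].
Proof.
case=> -[|u p] [// _ /andP[/= /mobius_walk[a [b [c [sz e]]]] _]] <-.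
exists a, b, c; split; first by rewrite sz size_rcons.
by move: e; rewrite last_rcons -addnA => /eqP; rewrite eqn_modDl => /eqP.
Qed.

(** The modulus [2 * k] is even, so the congruence preserves parity, and [k * c] has the parity of
    [c]. *)
Lemma closed_walk_parity_odd (k a b c : nat) :
  odd k -> b = a + k * c %[mod 2 * k] -> ~~ odd (a + b + c).
Proof.
move=> ok /(congr1 odd); rewrite !odd_mod ?oddM // oddD oddM ok /= !oddD => ->.
by rewrite !addbA addbb addFb addbb.
Qed.

Lemma closed_walk_odd_length (k a b c : nat) :
  ~~ odd k -> b = a + k * c %[mod 2 * k] -> odd (a + b + c) ->
  k < a + b + c.
Proof.
move=> ek e on; rewrite ltnNge; apply/negP => le_n.
have oc : odd c.
  move: (congr1 odd e) on; rewrite !odd_mod ?oddM // oddD oddM (negbTE ek) /=.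
  by rewrite addbF !oddD => ->; rewrite addbb.
have ek2 : b = a %[mod k].
  have := congr1 (modn^~ k) e; rewrite !modn_dvdm ?dvdn_mull //.
  by rewrite [k * c]mulnC addnC modnMDl.
have c_gt0 : 0 < c by case: (c) oc.
(* As [c] is positive and the length is at most [k], both [a] and [b] lie below [k]. *)
have eab : b = a by move: ek2; rewrite !modn_small //; clear e; lia.
(* Cancelling [a] leaves [2 * k] dividing [k * c], which contradicts [c] odd. *)
move: e; rewrite eab -{1}[a]addn0 => /eqP; rewrite eqn_modDl mod0n eq_sym.
rewrite -/(dvdn _ _) mulnC dvdn_pmul2l ?dvdn2 ?oc //.
by clear ek2; lia.
Qed.

Lemma cycle_mkseq (T : Type) (e : rel T) (g : nat -> T) (n : nat) :
  (forall i, i < n -> e (g i) (g i.+1)) -> e (g n) (g 0) ->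
  cycle e (mkseq g n.+1).
Proof.
move=> step close; rewrite /mkseq /= rcons_path; apply/andP; split; last first.
  rewrite last_map (last_nth 0) size_iota -[0 :: _]/(iota 0 n.+1).
  by rewrite nth_iota.
apply/(pathP (g 0)) => i; rewrite size_map size_iota => lt_in.
rewrite -[g 0 :: _]/(mkseq g n.+1) nth_mkseq ?(ltn_trans lt_in) //.
by rewrite (nth_map 0) ?size_iota // nth_iota // add1n; apply: step.
Qed.

(** A modulo-free sufficient condition for adjacency, within reach of [lia]; the wrap-around edge is
    kept only in the direction in which the zigzag cycles close. *)
Definition mobius_adj (k u v : nat) : bool :=
  [|| v == u.+1, u == v.+1, v == u + k, u == v + k
    | (u == (2 * k).-1) && (v == 0)].

Lemma mobius_adjW (k : nat) (u v : 'I_(2 * k)) :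
  mobius_adj k u v -> mobius_ladder u v.
Proof.
have := ltn_ord u; have := ltn_ord v => hv hu.
rewrite /mobius_adj /mobius_ladder /rim_edge /chord.
case/or4P => [/eqP e|/eqP e|/eqP e|/orP[/eqP e|/andP[/eqP eu /eqP ev]]].
- by apply/or4P/Or41; rewrite modn_small -?e.
- by apply/or4P/Or42; rewrite modn_small -?e.
- by apply/or4P/Or43; rewrite -e eqxx andbT; lia.
- by apply/or4P/Or44; rewrite -e eqxx andbT; lia.
- by apply/or4P/Or41; rewrite [val v]ev eu prednK ?modnn //; lia.
Qed.

Lemma mobius_spectrumI (k n : nat) (f : nat -> nat) : 3 <= n ->
  (forall i, i < n -> f i < 2 * k) ->
  (forall i j, i < j -> j < n -> f i <> f j) ->
  (forall i, i.+1 < n -> mobius_adj k (f i) (f i.+1)) ->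
  mobius_adj k (f n.-1) (f 0) ->
  cycle_spectrum (@mobius_ladder k) n.
Proof.
case: n => // n n_ge3 bnd inj step close.
pose x0 : 'I_(2 * k) := Ordinal (bnd 0 isT).
(* The default [x0] is never reached for indices up to [n], by [bnd]. *)
pose g i := insubd x0 (f i).
have gE i : i < n.+1 -> g i = f i :> nat by move/bnd=> h; rewrite /g insubdK.
exists (mkseq g n.+1); last by rewrite size_mkseq.
split; first by rewrite size_mkseq.
apply/andP; split.
  apply: cycle_mkseq => [i lt_in|]; apply: mobius_adjW; rewrite !gE //.
  - exact: step.
  - exact: ltnW.
apply/mkseq_uniqP => i j hi hj /(congr1 val); rewrite /= !gE // => eq_f.
by case: (ltngtP i j) => // lt_ij; [case: (inj i j) | case: (inj j i)].
Qed.

Lemma mobius_even_cycle (k m : nat) : 2 <= m <= k ->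
  cycle_spectrum (@mobius_ladder k) (2 * m).
Proof.
move=> hm.
(* Up the rim from [0] to [m - 1], along a chord to [k + m - 1], down to [k], and back to [0] by a
   chord. *)
apply: (@mobius_spectrumI _ _ (fun t => if t < m then t else k + (2 * m).-1 - t)).
- lia.
- by move=> i hi; case: ifP; lia.
- by move=> i j hi hj; do 2![case: ifP]; lia.
- by move=> i hi; rewrite /mobius_adj; do 2![case: ifP]; lia.
- by rewrite /mobius_adj; do 2![case: ifP]; lia.
Qed.

(* The blocks [2q, 2q + k, 2q + k + 1, 2q + 1] for [q < j], then [2j], then the
   rim vertices from [2j + k] up to [2k - 1]. *)
Definition zigzag (k j t : nat) : nat :=
  if t < 4 * j then
    2 * (t %/ 4) + nth 0 [:: 0; k; k.+1; 1] (t %% 4)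
  else if t == 4 * j then 2 * j else k + t - (2 * j).+1.

(** Case analysis through this view replaces division by 4 with linear equations in [q]. *)
Variant zigzag_spec (k j t : nat) : nat -> Prop :=
  | Zigzag0 q of q < j & t = 4 * q : zigzag_spec k j t (2 * q)
  | Zigzag1 q of q < j & t = 4 * q + 1 : zigzag_spec k j t (2 * q + k)
  | Zigzag2 q of q < j & t = 4 * q + 2 : zigzag_spec k j t (2 * q + k + 1)
  | Zigzag3 q of q < j & t = 4 * q + 3 : zigzag_spec k j t (2 * q + 1)
  | ZigzagMid of t = 4 * j : zigzag_spec k j t (2 * j)
  | ZigzagRim of 4 * j < t : zigzag_spec k j t (k + t - (2 * j).+1).

Lemma zigzagP (k j t : nat) : zigzag_spec k j t (zigzag k j t).
Proof.
rewrite /zigzag; case: ifP => [lt_t|ge_t]; last first.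
  by case: eqP => [e|ne]; [apply: ZigzagMid | apply: ZigzagRim; lia].
have lt_q : t %/ 4 < j by lia.
have := divn_eq t 4; have : t %% 4 < 4 by rewrite ltn_mod.
case: (t %% 4) => [|[|[|[|]]]] //= _ e.
- by rewrite addn0; apply: Zigzag0; lia.
- by apply: Zigzag1; lia.
- by rewrite -[k.+1]addn1 addnA; apply: Zigzag2; lia.
- by apply: Zigzag3; lia.
Qed.

(** The blocks give [4 * j] vertices, the vertex [2 * j] one more, and the final rim segment
    [k - 2 * j]; the edge from [2 * k - 1] to [0] closes the cycle. *)
Lemma mobius_zigzag_cycle (k j : nat) : 2 <= k -> 2 * j < k ->
  cycle_spectrum (@mobius_ladder k) (k + 1 + 2 * j).
Proof.
move=> k_ge2 hj; apply: (@mobius_spectrumI _ _ (zigzag k j)).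
- lia.
- by move=> i hi; case: zigzagP; lia.
- by move=> i i' hi hi'; case: zigzagP; case: zigzagP; lia.
- by move=> i hi; rewrite /mobius_adj; case: zigzagP; case: zigzagP; lia.
- by rewrite /mobius_adj; case: zigzagP; case: zigzagP; lia.
Qed.

Lemma cycle_spectrum_bounds (T : finType) (e : rel T) (n : nat) :
  cycle_spectrum e n -> 3 <= n <= #|T|.
Proof.
case=> s [s_ge3 /andP[_ s_uniq]] <-; rewrite s_ge3 /=.
by rewrite -(card_uniqP s_uniq) max_card.
Qed.

Lemma mobius_even_spectrum (k n : nat) :
  ~~ odd n -> 4 <= n <= 2 * k -> cycle_spectrum (@mobius_ladder k) n.
Proof.
move=> en hn; have -> : n = 2 * n./2 by lia.
by apply: mobius_even_cycle; lia.
Qed.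

Theorem theorem4 (k : nat) (hk : 4 <= k) :
  (odd k ->
     forall n : nat,
       cycle_spectrum (@mobius_ladder k) n <->
       (~~ odd n /\ 4 <= n <= 2 * k))
  /\
  (~~ odd k ->
     forall n : nat,
       cycle_spectrum (@mobius_ladder k) n <->
       ((~~ odd n /\ 4 <= n <= 2 * k) \/ k + 1 <= n <= 2 * k)).
Proof.
split=> parity_k n; split.
- move=> sp; have := cycle_spectrum_bounds _ _ _ sp; rewrite card_ord => bnd.
  case/mobius_spectrum_steps: sp => a [b [c [sz e]]].
  have := closed_walk_parity_odd _ _ _ _ parity_k e; rewrite sz => en.
  (* Evenness raises the lower bound from 3 to 4. *)
  by split=> //; clear e; lia.
- by case=> en hn; apply: mobius_even_spectrum.
- move=> sp; have := cycle_spectrum_bounds _ _ _ sp; rewrite card_ord => bnd.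
  case/mobius_spectrum_steps: sp => a [b [c [sz e]]].
  have := closed_walk_odd_length _ _ _ _ parity_k e; rewrite sz => long.
  by case: (boolP (odd n)) => [/long lt_kn|en]; [right | left]; clear e; lia.
- case=> [[en hn]|hn]; first exact: mobius_even_spectrum.
  case: (boolP (odd n)) => [on|en]; last by apply: mobius_even_spectrum; lia.
  (* Both [n] and [k + 1] are odd, so halving their difference is exact. *)
  have -> : n = k + 1 + 2 * (n - (k + 1))./2 by lia.
  by apply: mobius_zigzag_cycle; lia.
Qed.
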